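(* Let $I\subset(0,\infty)$ be an interval, let $f:I\to\mathbb{R}$ be differentiable on $I^{\circ}$, and let $a,b\in I$ with $a<b$, where $f'$ exists at every point of $[a,b]$ (one-sided derivative at $a$ or $b$ if that point is an endpoint of $I$), and $f'\in L[a,b]$. Let $q>1$, $\frac1p+\frac1q=1$, and suppose $|f'|^q$ is harmonically convex on $[a,b]$. Then $$\left|\frac{f(a)+f(b)}{2}-\frac{ab}{b-a}\int_a^b\frac{f(x)}{x^2}\,dx\right|\le\frac{ab(b-a)}{4(p+1)^{1/p}}\cdot\frac{1}{\left[(1-q)(1-2q)(b-a)^2\right]^{1/q}}$$ $$\times\Big\{\big(C_5(q;a,b)|f'(a)|^q+C_6(q;a,b)|f'(b)|^q\big)^{\frac1q}+\big(C_6(q;b,a)|f'(a)|^q+C_5(q;b,a)|f'(b)|^q\big)^{\frac1q}\Big\},$$ where, for $u,\vartheta>0$, $$C_5(q;u,\vartheta)=\left(\frac{u+\vartheta}{2}\right)^{1-2q}\left[\frac{\vartheta-3u}{2}-q(\vartheta-u)\right]+u^{2-2q},$$ $$C_6(q;u,\vartheta)=\left(\frac{u+\vartheta}{2}\right)^{1-2q}\left[\frac{3\vartheta-u}{2}-q(\vartheta-u)\right]+u^{1-2q}\left[u-2\vartheta+2q(\vartheta-u)\right].$$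
   Context: A function $g:J\to\mathbb{R}$ on an interval $J\subset\mathbb{R}\setminus\{0\}$ is harmonically convex if $g\left(\frac{xy}{tx+(1-t)y}\right)\le t\,g(y)+(1-t)\,g(x)$ for all $x,y\in J$ and $t\in[0,1]$. $L[a,b]$ denotes the Lebesgue integrable functions on $[a,b]$. *)

(* Defs.v *)
From HB Require Import structures.
From mathcomp Require Import all_boot all_order all_algebra.
From mathcomp Require Import all_classical all_reals all_analysis.
Set Implicit Arguments.
Unset Strict Implicit.
Unset Printing Implicit Defensive.
Import Order.TTheory GRing.Theory Num.Theory.
Import numFieldNormedType.Exports.
Local Open Scope classical_set_scope.
Local Open Scope ring_scope.

(* Only meant for J an interval that does not contain 0. *)
Definition harmonically_convex (R : realType) (J : set R) (g : R -> R) : Prop :=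
  forall x y t : R, J x -> J y -> 0 <= t <= 1 ->
    g (x * y / (t * x + (1 - t) * y)) <= t * g y + (1 - t) * g x.

Definition diff_quotient (R : realType) (f : R -> R) (x y : R) : R :=
  (f y - f x) / (y - x).

(* Derivative at x of the restriction of f to I: two-sided when x is interior
   to I, one-sided when x belongs to the interval I and is an endpoint of it.
   The values of f outside I are irrelevant.  As with `derive`, the value of
   `derive_within` is meaningful only where `derivable_within` holds. *)
Definition derivable_within (R : realType) (I : set R) (f : R -> R) (x : R)
    : Prop :=
  cvg (diff_quotient f x y @[y --> within I x^']).

Definition derive_within (R : realType) (I : set R) (f : R -> R) (x : R) : R :=
  lim (diff_quotient f x y @[y --> within I x^']).

Definition C5 (R : realType) (q u v : R) : R :=
  ((u + v) / 2) `^ (1 - 2 * q) * ((v - 3 * u) / 2 - q * (v - u))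
  + u `^ (2 - 2 * q).

Definition C6 (R : realType) (q u v : R) : R :=
  ((u + v) / 2) `^ (1 - 2 * q) * ((3 * v - u) / 2 - q * (v - u))
  + u `^ (1 - 2 * q) * (u - 2 * v + 2 * q * (v - u)).

(* Main.v *)
Require Import Defs.
From HB Require Import structures.
From mathcomp Require Import all_boot all_order all_algebra.
From mathcomp Require Import all_classical all_reals all_analysis.
From mathcomp Require Import ring lra.
Import Order.TTheory GRing.Theory Num.Theory.
Import numFieldNormedType.Exports.
Local Open Scope classical_set_scope.
Local Open Scope ring_scope.

(* With [m = (a + b) / 2], the function
   [F x = (a b / x - m) f x + a b \int_a^x f y / y^2 dy] has derivative
   [(a b / x - m) f' x] and satisfies [F a - F b = (b - a) ((f a + f b) / 2
   - a b / (b - a) \int_a^b f x / x^2 dx)].  Harmonic convexity bounds [|f'|^q]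
   at [a b / (t b + (1 - t) a)] by [t |f' a|^q + (1 - t) |f' b|^q], so Young's
   inequality with a free weight dominates [|F'|] on each side of the harmonic
   mean [a b / m] by the derivative of an explicit function.  The mean value
   inequality integrates this bound without any regularity of [f'], and
   optimising the weight gives the Hoelder constants. *)

(** * Real powers, increments and Young's inequality *)

Lemma powR_inv (R : realType) (x r : R) : 0 <= x -> x^-1 `^ r = (x `^ r)^-1.
Proof. by move=> x0; rewrite -powR_inv1// powRAC powR_inv1// powR_ge0. Qed.

(** The mean value theorem for [g + f] and [g - f], whose derivatives are nonnegative because
    [|df| <= dg], gives the two signs of the bound. *)
Lemma le_increment (R : realType) (f g df dg : R -> R) (l r : R) :
  l < r ->
  (forall x, x \in `]l, r[ -> is_derive x 1 f (df x)) ->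
  (forall x, x \in `]l, r[ -> is_derive x 1 g (dg x)) ->
  {within `[l, r], continuous f} -> {within `[l, r], continuous g} ->
  (forall x, x \in `]l, r[ -> `|df x| <= dg x :> R) ->
  `|f r - f l| <= g r - g l :> R.
Proof.
move=> lr Df Dg cf cg dfg; rewrite ler_norml; apply/andP; split.
  have Dgf x : x \in `]l, r[ -> is_derive x 1 (g + f) (dg x + df x).
    by move=> xlr; apply: is_deriveD; [exact: Dg|exact: Df].
  have cgf : {within `[l, r], continuous (g + f)}.
    by move=> x; apply: continuousD; [exact: cg|exact: cf].
  have [c clr E] := MVT lr Dgf cgf.
  have {}E : (g r + f r) - (g l + f l) = (dg c + df c) * (r - l) := E.
  have : 0 <= (dg c + df c) * (r - l).
    rewrite mulr_ge0 ?subr_ge0 ?(ltW lr)//.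
    by have := dfg _ clr; rewrite ler_norml => /andP[]; lra.
  lra.
have Dgf x : x \in `]l, r[ -> is_derive x 1 (g - f) (dg x - df x).
  by move=> xlr; apply: is_deriveB; [exact: Dg|exact: Df].
have cgf : {within `[l, r], continuous (g - f)}.
  by move=> x; apply: continuousD; [exact: cg|exact/continuousN/cf].
have [c clr E] := MVT lr Dgf cgf.
have {}E : (g r - f r) - (g l - f l) = (dg c - df c) * (r - l) := E.
have : 0 <= (dg c - df c) * (r - l).
  rewrite mulr_ge0 ?subr_ge0 ?(ltW lr)//.
  by have := dfg _ clr; rewrite ler_norml => /andP[]; lra.
lra.
Qed.

(** Young's inequality for [nu^(1/p) x] and [nu^(-1/p) y]; conjugacy turns the exponent [- q / p] of
    the second weight into [1 - q]. *)
Lemma young_weighted (R : realType) (p q nu x y : R) :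
  0 < p -> 0 < q -> p^-1 + q^-1 = 1 -> 0 < nu -> 0 <= x -> 0 <= y ->
  x * y <= nu * (x `^ p / p) + nu `^ (1 - q) * (y `^ q / q).
Proof.
move=> p0 q0 pq nu0 x0 y0.
have := @conjugate_powR R (nu `^ p^-1 * x) (nu `^ (- p^-1) * y) p q.
rewrite !powRM ?powR_ge0// -!powRrM mulVf ?gt_eqF// powRr1 ?(ltW nu0)//.
have -> : - p^-1 * q = 1 - q.
  have -> : p^-1 = 1 - q^-1 by rewrite -pq addrK.
  by rewrite mulNr mulrBl mulVf ?gt_eqF// mul1r opprB.
rewrite mulrACA powRN mulfV ?mul1r ?gt_eqF ?powR_gt0//.
rewrite -!mulrA; apply => //; apply: mulr_ge0 => //.
  exact: powR_ge0.
by rewrite invr_ge0 powR_ge0.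
Qed.

(* The bounds are the weighted Young inequalities; the optimal weight is
   [(y / x)^(1/q)], and [nu -> 0] settles the case [y = 0]. *)
Lemma young_optimal (R : realType) (p q x y z : R) :
  0 < p -> 0 < q -> p^-1 + q^-1 = 1 -> 0 < x -> 0 <= y ->
  (forall nu, 0 < nu -> z <= nu * (x / p) + nu `^ (1 - q) * (y / q)) ->
  z <= x `^ p^-1 * y `^ q^-1.
Proof.
move=> p0 q0 pq x0; rewrite le_eqVlt => /predU1P[<-|y0] H.
  rewrite powR0 ?invr_eq0 ?gt_eqF// mulr0 leNgt; apply/negP => z0.
  have xp : 0 < x / p by rewrite divr_gt0.
  (* At this weight the bound reads [z <= z / 2], contradicting [0 < z]. *)
  have := H (z / (x / p) / 2).
  rewrite mul0r mulr0 addr0 mulrAC divfK ?gt_eqF// !divr_gt0// => /(_ isT).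
  lra.
set nu := (y / x) `^ q^-1.
have nu0 : 0 < nu by rewrite powR_gt0 ?divr_gt0.
have nuq : nu `^ q = y / x.
  by rewrite /nu -powRrM mulVf ?gt_eqF// powRr1// ltW// divr_gt0.
have nux : nu * x = x `^ p^-1 * y `^ q^-1.
  have -> : p^-1 = 1 - q^-1 by rewrite -pq addrK.
  have xB : x `^ (1 - q^-1) = x * x^-1 `^ q^-1.
    rewrite powRB ?powRr1 ?ltW//; last by rewrite (gt_eqF x0) implybT.
    by rewrite powR_inv ?ltW.
  by rewrite xB /nu powRM ?invr_ge0 ?ltW// mulrC [_ `^ _ * _]mulrC mulrA.
(* At the optimal weight the two terms become [nu x / p] and [nu x / q], which conjugacy adds up to
   [nu x]. *)
have nuy : nu `^ (1 - q) * y = nu * x.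
  rewrite powRB; last by rewrite (gt_eqF nu0) implybT.
  rewrite powRr1 ?ltW// nuq invf_div.
  by rewrite -mulrA divfK ?gt_eqF.
apply: (le_trans (H _ nu0)).
by rewrite !mulrA nuy -mulrDr pq mulr1 nux.
Qed.

(** * Powers of affine functions: derivatives, continuity, primitives *)

Lemma is_derive1_continuous (R : realType) (f : R -> R) (x df : R) :
  is_derive x 1 f df -> {for x, continuous f}.
Proof. by case=> /derivable1_diffP/differentiable_continuous. Qed.

Lemma is_derive_powR_affine (R : realType) (u v r x : R) :
  0 < u + x * v ->
  is_derive x 1 (fun t : R => (u + t * v) `^ r)
    (r * (u + x * v) `^ (r - 1) * v).
Proof.
move=> x0.
have Dx : is_derive x 1 (fun t : R => u + t * v) v.
  by apply: is_derive_eq; rewrite scaler0 !add0r mul1r [_%:A]mulr1.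
have D := is_derive1_powR r x0.
exact: (@is_derive1_comp _ (fun y => y `^ r) (fun t => u + t * v) _ _ _ D Dx).
Qed.

(** The base vanishes at [2^-1], so differentiability covers only [t < 2^-1]. At the right endpoint,
    [0 < r] makes the power tend to 0 as the base decreases to 0. *)
Lemma continuous_powR_half (R : realType) (r : R) : 0 < r ->
  {within `[0, 2^-1], continuous (fun t : R => (1 + t * -2) `^ r)}.
Proof.
move=> r0.
have c t : t < 2^-1 ->
    {for t, continuous (fun t : R => (1 + t * -2) `^ r)}.
  by move=> t2; apply: is_derive1_continuous; apply: is_derive_powR_affine; lra.
apply/continuous_within_itvP; first by rewrite invr_gt0.
split.
- by move=> t; rewrite in_itv/= => /andP[_]; exact: c.
- apply: cvg_at_right_filter; apply: c; by rewrite invr_gt0.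
- rewrite mulrN mulVf// subrr powR0 ?gt_eqF//.
  apply: (@cvg_comp _ _ _ (fun t : R => 1 + t * -2) (fun y => y `^ r) _ 0^'+);
    last exact: powR_cvg0.
  move=> A [e /= e0 He]; near=> t.
  have t2 : t < 2^-1 by near: t; exact: nbhs_left_lt.
  have te : 2^-1 - e / 2 < t by near: t; apply: nbhs_left_gt; lra.
  by apply: He => /=; rewrite ?sub0r ?normrN ?gtr0_norm; lra.
Unshelve. all: by end_near. Qed.

(** With [s = u + t (v - u)], the factor [t P + (1 - t) Q] equals
    [((P - Q) s + (v Q - u P)) / (v - u)]. The integrand is thus a combination of [s^(1 - 2 q)] and
    [s^(- 2 q)], and [1 < q] keeps both denominators of the primitive nonzero. *)
Lemma is_derive_powR_segment (R : realType) (u v P Q q t : R) :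
  u != v -> 1 < q -> 0 < u + t * (v - u) ->
  is_derive t 1
    (fun t : R => ((P - Q) / (2 - 2 * q) * (u + t * (v - u)) `^ (2 - 2 * q)
      + (v * Q - u * P) / (1 - 2 * q) * (u + t * (v - u)) `^ (1 - 2 * q))
      / (v - u) ^+ 2)
    ((u + t * (v - u)) `^ (- 2 * q) * (t * P + (1 - t) * Q)).
Proof.
move=> uv q1 s0.
have D1 := is_derive_powR_affine _ _ _ (2 - 2 * q) _ s0.
have D2 := is_derive_powR_affine _ _ _ (1 - 2 * q) _ s0.
apply: is_derive_eq.
set s := u + t * (v - u) in s0 *.
have -> : 2 - 2 * q - 1 = 1 + - 2 * q by lra.
have -> : 1 - 2 * q - 1 = - 2 * q by lra.
have -> : s `^ (1 + - 2 * q) = s * s `^ (- 2 * q).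
  by rewrite powRD ?powRr1 ?ltW// (gt_eqF s0) implybT.
move: (s `^ (- 2 * q)) => c; rewrite /s.
rewrite /GRing.scale /=.
have vu : v - u != 0 by rewrite subr_eq0 eq_sym.
have q2 : 2 - 2 * q != 0 by apply/eqP; lra.
have q3 : 1 - 2 * q != 0 by apply/eqP; lra.
by field; rewrite q2 q3 vu.
Qed.

(** This identifies the constants: divided by [2 (1 - q) (1 - 2 q) (v - u)^2], [C5] and [C6] are the
    integrals over [[0, 1/2]] of [t s^(- 2 q)] and [(1 - t) s^(- 2 q)], where
    [s = u + t (v - u)]. *)
Lemma powR_segment_increment (R : realType) (u v P Q q : R)
  (N := fun t : R => ((P - Q) / (2 - 2 * q) * (u + t * (v - u)) `^ (2 - 2 * q)
      + (v * Q - u * P) / (1 - 2 * q) * (u + t * (v - u)) `^ (1 - 2 * q))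
      / (v - u) ^+ 2) :
  0 < u -> 0 < v -> u != v -> 1 < q ->
  N 2^-1 - N 0 = (C5 q u v * P + C6 q u v * Q)
                 / (2 * ((1 - q) * (1 - 2 * q) * (v - u) ^+ 2)).
Proof.
move=> u0 v0 uv q1; rewrite /N /C5 /C6 mul0r addr0.
have -> : u + 2^-1 * (v - u) = (u + v) / 2 by field.
have m0 : 0 < (u + v) / 2 by lra.
have E (x : R) : 0 < x -> x `^ (2 - 2 * q) = x * x `^ (1 - 2 * q).
  move=> x0; have -> : 2 - 2 * q = 1 + (1 - 2 * q) by lra.
  by rewrite powRD ?powRr1 ?ltW// (gt_eqF x0) implybT.
rewrite !E//.
move: (_ `^ _) (u `^ _) => c d.
have vu : v - u != 0 by rewrite subr_eq0 eq_sym.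
have q2 : 1 - q != 0 by apply/eqP; lra.
have q3 : 1 - 2 * q != 0 by apply/eqP; lra.
have q4 : 2 - 2 * q != 0 by apply/eqP; lra.
by field; rewrite q2 q3 q4 vu.
Qed.

(** * Hoelder's bound on [[0, 1/2]] *)

(** The two factors of the dominating function are [1 - 2 t] and [s^(-2) (t P + (1 - t) Q)^(1/q)],
    with [s = u + t (v - u)]. The integral of the [p]-th power of the first is [(2 (p + 1))^-1], and
    that of the [q]-th power of the second is [Y]. *)
Lemma half_segment_bound (R : realType) (p q u v P Q c : R) (f df : R -> R) :
  0 < u -> 0 < v -> u != v -> 0 < p -> 1 < q -> p^-1 + q^-1 = 1 ->
  0 <= P -> 0 <= Q -> 0 < c ->
  {within `[0, 2^-1], continuous f} ->
  (forall t : R, t \in `]0, 2^-1[ -> is_derive t 1 f (df t)) ->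
  (forall t : R, t \in `]0, 2^-1[ ->
    `|df t| <= c * ((1 + t * -2) * ((u + t * (v - u)) `^ (-2)
                                    * (t * P + (1 - t) * Q) `^ q^-1)) :> R) ->
  let Y := (C5 q u v * P + C6 q u v * Q)
           / (2 * ((1 - q) * (1 - 2 * q) * (v - u) ^+ 2)) in
  0 <= Y /\ `|f 2^-1 - f 0| <= c * ((2 * (p + 1))^-1 `^ p^-1 * Y `^ q^-1) :> R.
Proof.
move=> u0 v0 uv p0 q1 pq P0 Q0 c0 cf Df dfle Y.
have q0 : 0 < q by lra.
have half0 : 0 < 2^-1 :> R by rewrite invr_gt0.
have s_gt0 (t : R) : t \in `[0, 2^-1] -> 0 < u + t * (v - u).
  rewrite in_itv/= => /andP[t0 t2].
  have -> : u + t * (v - u) = (1 - t) * u + t * v by ring.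
  by rewrite ltr_pwDl ?mulr_gt0 ?mulr_ge0//; lra.
(* [N] and [- W / (2 (p + 1))] are primitives of the [q]-th and [p]-th powers of
   the two factors paired by Young's inequality. *)
pose N (t : R) := ((P - Q) / (2 - 2 * q) * (u + t * (v - u)) `^ (2 - 2 * q)
      + (v * Q - u * P) / (1 - 2 * q) * (u + t * (v - u)) `^ (1 - 2 * q))
      / (v - u) ^+ 2.
pose dN (t : R) := (u + t * (v - u)) `^ (- 2 * q) * (t * P + (1 - t) * Q).
have DN (t : R) : t \in `[0, 2^-1] -> is_derive t 1 N (dN t).
  by move=> /s_gt0; exact: is_derive_powR_segment.
have sub (t : R) : t \in `]0, 2^-1[ -> t \in `[0, 2^-1].
  exact: subset_itv_oo_cc.
have cN : {within `[0, 2^-1], continuous N}.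
  by apply: derivable_within_continuous => t /DN[].
have gamma0 (t : R) : t \in `]0, 2^-1[ -> 0 <= t * P + (1 - t) * Q.
  by rewrite in_itv/= => /andP[t0 t2]; rewrite addr_ge0// mulr_ge0//; lra.
have NY : N 2^-1 - N 0 = Y by exact: powR_segment_increment.
(* By the mean value theorem [Y] is half of a value of [dN], which is nonnegative on the open
   segment. *)
have Y0 : 0 <= Y.
  have [t tI] := MVT half0 (fun t tI => DN t (sub t tI)) cN.
  rewrite NY => ->; rewrite /dN subr0.
  by rewrite !mulr_ge0 ?powR_ge0 ?gamma0 ?(ltW half0).
split => //.
rewrite -ler_pdivrMl//; apply: young_optimal => //.
  by rewrite invr_gt0; lra.
move=> nu nu0; rewrite ler_pdivrMl//.
pose W (t : R) : R := (1 + t * -2) `^ (p + 1).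
have w_gt0 (t : R) : t \in `]0, 2^-1[ -> 0 < 1 + t * -2.
  by rewrite in_itv/= => /andP[_ t2]; lra.
have DW (t : R) : t \in `]0, 2^-1[ ->
    is_derive t 1 W ((p + 1) * (1 + t * -2) `^ (p + 1 - 1) * -2).
  by move=> /w_gt0; exact: is_derive_powR_affine.
have cW : {within `[0, 2^-1], continuous W}.
  by apply: continuous_powR_half; lra.
(* These coefficients make the derivative of [g] exactly [c] times the weighted Young bound; the 2
   and [p + 1] in [k1] cancel the factors produced by differentiating [W]. *)
set k1 := c * nu / (2 * (p + 1) * p); set k2 := c * nu `^ (1 - q) / q.
pose g (t : R) : R := k2 * N t - k1 * W t.
have -> : c * (nu * ((2 * (p + 1))^-1 / p) + nu `^ (1 - q) * (Y / q))
          = g 2^-1 - g 0.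
  rewrite -NY -[g _]/(k2 * N _ - k1 * W _) -[g 0]/(k2 * N _ - k1 * W _).
  rewrite /W mul0r addr0 powR1 mulrN mulVf// subrr powR0; last first.
    by apply/eqP; lra.
  rewrite /k1 /k2; field; rewrite !gt_eqF//; lra.
pose dg (t : R) := k2 * dN t - k1 * ((p + 1) * (1 + t * -2) `^ (p + 1 - 1) * -2).
have Dg (t : R) : t \in `]0, 2^-1[ -> is_derive t 1 g (dg t).
  move=> tI; have D1 := is_deriveZ k2 (DN _ (sub _ tI)).
  have D2 := is_deriveZ k1 (DW _ tI).
  exact: (is_deriveB D1 D2).
have cg : {within `[0, 2^-1], continuous g}.
  move/subspace_continuousP in cN; move/subspace_continuousP in cW.
  apply/subspace_continuousP => t tI.
  by apply: cvgB; (apply: cvgM; [exact: cvg_cst|]); [exact: cN|exact: cW].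
suff dfg (t : R) : t \in `]0, 2^-1[ -> `|df t| <= dg t :> R.
  exact: (le_increment R f g df dg 0 2^-1 half0 Df Dg cf cg dfg).
move=> tI; apply: (le_trans (dfle _ tI)).
have := young_weighted _ p q nu (1 + t * -2) ((u + t * (v - u)) `^ (-2)
                                    * (t * P + (1 - t) * Q) `^ q^-1).
move=> /(_ p0 q0 pq nu0 (ltW (w_gt0 _ tI))).
rewrite mulr_ge0 ?powR_ge0// => /(_ isT) H.
have {}H := ler_wpM2l (ltW c0) H.
apply: (le_trans H); rewrite le_eqVlt; apply/predU1P; left.
rewrite powRM ?powR_ge0// -!powRrM mulVf ?gt_eqF// powRr1 ?gamma0//.
rewrite /dg addrK /k1 /k2 /dN; field; rewrite !gt_eqF//; lra.
Qed.

(** * Derivatives relative to an interval *)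

Lemma within_id (T : Type) (F : set_system T) (D : set T) :
  Filter F -> F D -> within D F = F.
Proof.
move=> FF FD; apply/funext => A; apply/propext; rewrite /within /=; split.
  by move=> H; apply: filterS2 FD H => x Dx; apply.
by apply: filterS.
Qed.

(** Off [x], [f y] is the difference quotient times [y - x], plus [f x], so it tends to [f x]; at
    [x] itself the value is already [f x]. This supplies continuity at the endpoints, where only a
    one-sided derivative may exist. *)
Lemma derivable_within_cvg (R : realType) (I : set R) (f : R -> R) (x : R) :
  derivable_within I f x -> f y @[y --> within I (nbhs x)] --> f x.
Proof.
move=> /cvg_ex[l dfl].
have fx : f y @[y --> within I x^'] --> f x.
  have : diff_quotient f x y * (y - x) + f x @[y --> within I x^'] -->
         l * 0 + f x.
    apply: cvgD; last exact: cvg_cst.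
    apply: cvgM => //; rewrite -(subrr x); apply: cvgB; last exact: cvg_cst.
    by do 2!apply: cvg_within_filter; exact: cvg_id.
  rewrite mulr0 add0r; apply: cvg_trans; apply: near_eq_cvg.
  apply: (cvg_within I); near=> y.
  by rewrite /diff_quotient divfK ?subrK// subr_eq0; near: y;
    exact: nbhs_dnbhs_neq.
move=> A fxA.
have H : \forall y \near x, y != x -> I y -> A (f y) := fx _ fxA.
suff : \forall y \near x, I y -> A (f y) by [].
apply: filterS H => y H Iy.
by have [->|yx] := eqVneq y x; [exact: nbhs_singleton|exact: H].
Unshelve. all: by end_near. Qed.

(** Off [x] the difference quotient is Caratheodory's slope function, continuous at [x]; around an
    interior point, restricting to [I] does not change the punctured filter. *)
Lemma derive_within_interior (R : realType) (I : set R) (f : R -> R) (x : R) :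
  I°%classic x -> derivable f x 1 -> is_derive x 1 f (derive_within I f x).
Proof.
move=> Ix dfx; apply: DeriveDef => //.
have dq : diff_quotient f x y @[y --> x^'] --> 'D_1 f x.
  have /is_derive1_caratheodory[g [fg gc <-]] := derivableP dfx.
  apply: (@cvg_trans _ (g y @[y --> x^'])); last exact: cvg_within_filter.
  apply: near_eq_cvg; near=> y.
  by rewrite /diff_quotient fg mulfK// subr_eq0; near: y; exact: nbhs_dnbhs_neq.
rewrite /derive_within within_id//; last exact: nbhs_dnbhs.
exact/esym/cvg_lim.
Unshelve. all: by end_near. Qed.

(** * Change of variable on each side of the harmonic mean *)

Lemma within_continuous_comp (T U V : topologicalType) (A : set T) (B : set U)
    (f : T -> U) (g : U -> V) :
  {in A, continuous f} -> (forall x, A x -> B (f x)) ->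
  {within B, continuous g} -> {within A, continuous (g \o f)}.
Proof.
move=> cf AB /subspace_continuousP cg; apply/subspace_continuousP => x Ax.
move=> W /(cg _ (AB _ Ax)) /= /(cf _ (mem_set Ax)) /=.
by rewrite /within /= !nbhs_simpl/=; apply: filterS => y H Ay; apply: H; exact: AB.
Qed.

(** The substitution [x = a b / (u + t (v - u))] carries [[0, 1/2]] onto the part between
    [a b / u = v] and the harmonic mean, and the two choices of [(u, v)] cover both sides. [B] is
    given by an equation so that its two terms may come in either order. *)
Lemma harmonic_half_bound (R : realType) (p q a b u v B : R) (F df : R -> R) :
  0 < a -> a < b -> (u = a /\ v = b) \/ (u = b /\ v = a) ->
  0 < p -> 1 < q -> p^-1 + q^-1 = 1 ->
  {within `[a, b], continuous F} ->
  (forall x : R, x \in `]a, b[ ->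
    is_derive x 1 F ((a * b / x - (a + b) / 2) * df x)) ->
  harmonically_convex `[a, b] (fun x : R => `|df x| `^ q) ->
  B = C5 q u v * `|df u| `^ q + C6 q u v * `|df v| `^ q ->
  let Y := B / (2 * ((1 - q) * (1 - 2 * q) * (b - a) ^+ 2)) in
  0 <= Y /\
  `|F (a * b / ((a + b) / 2)) - F (a * b / u)|
    <= a * b * (b - a) ^+ 2 / 2 * ((2 * (p + 1))^-1 `^ p^-1 * Y `^ q^-1) :> R.
Proof.
move=> a0 ab uvE p0 q1 pq cF DF df_conv BE Y.
have uvab : [/\ 0 < u, 0 < v, u != v & u * v = a * b].
  by case: uvE => -[-> ->]; split; rewrite ?(lt_trans a0 ab)// ?(lt_eqF ab)
     ?(gt_eqF ab)// mulrC.
have [u0 v0 uv uvM] := uvab.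
have uvD : u + v = a + b by case: uvE => -[-> ->] //; rewrite addrC.
have uvB2 : (v - u) ^+ 2 = (b - a) ^+ 2 by case: uvE => -[-> ->] //; ring.
have q0 : 0 < q by lra.
have b0 : 0 < b by exact: lt_trans ab.
pose s (t : R) := u + t * (v - u).
pose x (t : R) := a * b / s t.
have s_itv (t : R) : 0 <= t <= 2^-1 -> a <= s t <= b.
  by move=> t01; case: uvE => -[uE vE]; rewrite /s uE vE; nra.
have s_itvoo (t : R) : 0 < t < 2^-1 -> a < s t < b.
  by move=> t01; case: uvE => -[uE vE]; rewrite /s uE vE; nra.
have s0 (t : R) : t \in `[0, 2^-1] -> 0 < s t.
  by rewrite in_itv/= => /s_itv /andP[]; lra.
have x_itv (t : R) : `[0, 2^-1]%classic t -> `[a, b]%classic (x t).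
  move=> /= t01; have st0 := s0 _ t01; move: t01.
  rewrite !in_itv/= => /s_itv /andP[sa sb].
  by rewrite /x ler_pdivlMr// ler_pdivrMr// [b * _]mulrC ler_pM2r// ler_pM2l// sb sa.
have x_itvoo (t : R) : t \in `]0, 2^-1[ -> x t \in `]a, b[.
  move=> t01; have st0 : 0 < s t by apply: s0; exact: subset_itv_oo_cc.
  move: t01; rewrite !in_itv/= => /s_itvoo /andP[sa sb].
  by rewrite /x ltr_pdivlMr// ltr_pdivrMr// [b * _]mulrC ltr_pM2r// ltr_pM2l// sb sa.
have Dx (t : R) : t \in `[0, 2^-1] ->
    is_derive t 1 x (- (a * b * (v - u)) / s t ^+ 2).
  move=> /s0 st0.
  have Ds : is_derive t 1 s (v - u).
    by apply: is_derive_eq; rewrite scaler0 !add0r mul1r [_%:A]mulr1.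
  have sn0 : s t != 0 by rewrite gt_eqF.
  have Dsv := @is_deriveV _ s t _ 1 sn0 Ds.
  apply: is_derive_eq (is_deriveZ (a * b) Dsv) _.
  by rewrite /GRing.scale/=; field.
have cx : {in `[0, 2^-1]%classic, continuous x}.
  by move=> t; rewrite inE/= => /Dx; exact: is_derive1_continuous.
have cphi := within_continuous_comp _ _ _ _ _ _ _ cx x_itv cF.
pose dphi (t : R) := (a * b / x t - (a + b) / 2) * df (x t)
                     * (- (a * b * (v - u)) / s t ^+ 2).
have Dphi (t : R) : t \in `]0, 2^-1[ -> is_derive t 1 (F \o x) (dphi t).
  move=> t01; have D1 := DF _ (x_itvoo _ t01).
  have D2 := Dx _ (subset_itv_oo_cc t01).
  exact: (@is_derive1_comp _ F x _ _ _ D1 D2).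
have c0 : 0 < a * b * (b - a) ^+ 2 / 2.
  by rewrite divr_gt0// !mulr_gt0// subr_gt0.
have := half_segment_bound R p q u v (`|df u| `^ q) (`|df v| `^ q) _ _ _
  u0 v0 uv p0 q1 pq (powR_ge0 _ _) (powR_ge0 _ _) c0 cphi Dphi.
rewrite uvB2 -BE -/Y /= /x /s.
have -> : u + 2^-1 * (v - u) = (a + b) / 2 by rewrite -uvD; field.
rewrite mul0r addr0; apply => t t01.
have t01' := subset_itv_oo_cc t01.
have st0 := s0 _ t01'.
have [t0 t2] : 0 < t /\ t < 2^-1 by move: t01; rewrite in_itv => /andP.
have xI := x_itvoo _ t01.
have dfx : `|df (x t)| <= (t * `|df u| `^ q + (1 - t) * `|df v| `^ q) `^ q^-1 :> R.
  have uab : `[a, b]%classic u.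
    by rewrite /= in_itv/=; case: uvE => -[-> _]; rewrite lexx (ltW ab).
  have vab : `[a, b]%classic v.
    by rewrite /= in_itv/=; case: uvE => -[_ ->]; rewrite lexx (ltW ab).
  have tt : 0 <= t <= 1 by apply/andP; split; lra.
  (* The weights cross in harmonic convexity: weight [t] on [v] in the denominator becomes weight
     [t] on the value at [u]. *)
  have := df_conv v u t vab uab tt.
  have -> : v * u / (t * v + (1 - t) * u) = x t.
    by rewrite /x -uvM [v * u]mulrC; congr (_ / _); rewrite /s; ring.
  move=> H; rewrite -[leLHS]powRr1// -[X in _ `^ X](mulfV (lt0r_neq0 q0)) powRrM.
  apply: ge0_ler_powR H; rewrite ?invr_ge0 ?(ltW q0)// ?nnegrE ?powR_ge0//.
  by rewrite addr_ge0// mulr_ge0 ?powR_ge0//; lra.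
(* Since [a b / x t = s t], the first factor is [(v - u) (t - 1/2)]; multiplied by the derivative of
   [x] it gives the square [(v - u)^2] and a positive sign for [t < 1/2]. *)
have dphiE : dphi t = a * b * (b - a) ^+ 2 / 2 * ((1 + t * -2) / s t ^+ 2)
                      * df (x t).
  rewrite /dphi -uvB2 -uvD.
  have -> : a * b / x t = s t.
    by rewrite /x; field; rewrite !gt_eqF.
  by have := gt_eqF st0; rewrite /s => /negbT ?; field.
have k0 : 0 <= a * b * (b - a) ^+ 2 / 2 * ((1 + t * -2) / s t ^+ 2).
  rewrite mulr_ge0 ?(ltW c0)// divr_ge0 ?exprn_ge0 ?(ltW st0)//; lra.
rewrite dphiE normrM (ger0_norm k0).
apply: (le_trans (ler_wpM2l k0 dfx)).
by rewrite (powR_invn 2 (ltW st0)) !mulrA.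
Qed.

(** * The auxiliary function [F] and the final constants *)

(** The derivative of [a b / x] is [- a b / x^2], so the term in [f] from the product rule cancels
    against the derivative of the integral, leaving only the term in [df]. *)
Lemma harmonic_primitive (R : realType) (a b : R) (f df : R -> R)
    (F := fun x : R => (a * b / x - (a + b) / 2) * f x
      + a * b * \int[@lebesgue_measure R]_(y in `[a, x]) (f y / y ^+ 2)) :
  0 < a -> a < b -> {within `[a, b], continuous f} ->
  (forall x : R, x \in `]a, b[ -> is_derive x 1 f (df x)) ->
  {within `[a, b], continuous F} /\
  (forall x : R, x \in `]a, b[ ->
    is_derive x 1 F ((a * b / x - (a + b) / 2) * df x)).
Proof.
move=> a0 ab cf Df.
pose k (x : R) : R := a * b / x - (a + b) / 2.
pose h (x : R) : R := f x / x ^+ 2.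
have Dinv (x : R) : 0 < x -> is_derive x 1 (fun y : R => y^-1) (- x ^- 2).
  move=> x0; apply: is_derive_eq (is_deriveV _ _) _; first exact: lt0r_neq0.
  by rewrite [_%:A]mulr1.
have Dk (x : R) : 0 < x -> is_derive x 1 k (- (a * b) / x ^+ 2).
  move=> /Dinv Dx; have D1 := is_deriveZ (a * b) Dx.
  apply: is_derive_eq (is_deriveB D1 (is_derive_cst ((a + b) / 2) x 1)) _.
  by rewrite subr0 /GRing.scale/= mulrN mulNr.
have itv0 (x : R) : x \in `[a, b] -> 0 < x.
  by rewrite in_itv/= => /andP[/(lt_le_trans a0)].
move/subspace_continuousP in cf.
have withinT (g : R -> R) (x : R) : {for x, continuous g} ->
    g @ within `[a, b] (nbhs x) --> g x.
  by move=> gx; apply: cvg_within_filter; exact: gx.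
have ch : {within `[a, b], continuous h}.
  apply/subspace_continuousP => x /[dup] xab /itv0 x0.
  apply: cvgM; first exact: cf.
  have Dx := Dinv _ x0.
  apply: (withinT (fun y => (y ^+ 2)^-1)).
  apply: (@continuousV _ _ (fun y : R => y ^+ 2)); first by rewrite expf_neq0 ?gt_eqF.
  exact: exprn_continuous.
have ih : (@lebesgue_measure R).-integrable `[a, b] (EFin \o h).
  by apply: continuous_compact_integrable => //; exact: segment_compact.
have cH := parameterized_integral_continuous (ltW ab) ih.
move/subspace_continuousP in cH.
split.
  apply/subspace_continuousP => x /[dup] xab /itv0 x0.
  apply: cvgD; apply: cvgM.
  - by apply: (withinT k); exact: is_derive1_continuous (Dk _ x0).
  - exact: cf.
  - exact: cvg_cst.
  - exact: cH.
move=> x xab; have x0 := itv0 _ (subset_itv_oo_cc xab).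
have [ax xb] : a < x /\ x < b by move: xab; rewrite in_itv => /andP.
have hx : {for x, continuous h} by exact: within_continuous_continuous xab.
have [dH HE] := continuous_FTC1_closed xb ih ax hx.
have DH := DeriveDef dH (etrans (esym (derive1E _ _)) HE).
have D1 := is_deriveM (Dk _ x0) (Df _ xab).
apply: is_derive_eq (is_deriveD D1 (is_deriveZ (a * b) DH)) _.
rewrite /GRing.scale/= /k /h; field; exact: lt0r_neq0.
Qed.

(** The factors 2 under the [p]-th and [q]-th roots merge through [2^(1/p) 2^(1/q) = 2]. *)
Lemma hoelder_constants (R : realType) (p q D B1 B2 : R) :
  0 < p -> p^-1 + q^-1 = 1 -> 0 < D ->
  0 <= B1 / (2 * D) -> 0 <= B2 / (2 * D) ->
  (2 * (p + 1))^-1 `^ p^-1 * (B1 / (2 * D)) `^ q^-1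
    + (2 * (p + 1))^-1 `^ p^-1 * (B2 / (2 * D)) `^ q^-1
  = (2 * (p + 1) `^ p^-1)^-1 * (D `^ q^-1)^-1 * (B1 `^ q^-1 + B2 `^ q^-1).
Proof.
move=> p0 pq D0 Y1 Y2.
have p1_gt0 : 0 < p + 1 by rewrite addr_gt0.
have D20 : 0 <= 2 * D by rewrite mulr_ge0// ltW.
have DB (B : R) : 0 <= B / (2 * D) ->
    (B / (2 * D)) `^ q^-1 = B `^ q^-1 / (2 `^ q^-1 * D `^ q^-1).
  move=> BD; have B0 : 0 <= B.
    by move: BD; rewrite pmulr_lge0// invr_gt0 mulr_gt0.
  by rewrite powRM ?invr_ge0// powR_inv// (powRM _ (ler0n _ 2) (ltW D0)).
rewrite !DB// powR_inv ?mulr_ge0 ?(ltW p1_gt0)// powRM ?(ltW p1_gt0)//.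
have E2 : 2 `^ p^-1 * 2 `^ q^-1 = 2 :> R.
  by rewrite -powRD ?pq ?powRr1// oner_eq0.
have p20 : 2 `^ p^-1 != 0 :> R by rewrite gt_eqF// powR_gt0.
have q2E : 2 `^ q^-1 = 2 / 2 `^ p^-1 :> R.
  by rewrite -[X in X / _]E2 mulrAC mulfV ?mul1r.
have Dq0 : D `^ q^-1 != 0 by rewrite gt_eqF// powR_gt0.
have pp0 : (p + 1) `^ p^-1 != 0 by rewrite gt_eqF// powR_gt0.
by rewrite q2E; field; rewrite ?p20 ?Dq0 ?pp0.
Qed.

(** * The two sides joined at the harmonic mean *)

Theorem corollary8 (R : realType) (I : set R) (f : R -> R) (a b p q : R)
  (hI : is_interval I) (hIpos : I `<=` `]0, +oo[)
  (hf : forall x : R, (I°)%classic x -> derivable f x 1)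
  (ha : I a) (hb : I b) (hab : a < b)
  (hfab : forall x : R, x \in `[a, b] -> derivable_within I f x)
  (hint : (@lebesgue_measure R).-integrable `[a, b]
            (EFin \o derive_within I f))
  (hq : 1 < q) (hpq : p^-1 + q^-1 = 1)
  (hconv : harmonically_convex `[a, b]
             (fun x : R => `|derive_within I f x| `^ q)) :
  `| (f a + f b) / 2
     - a * b / (b - a)
       * (\int[@lebesgue_measure R]_(x in `[a, b]) (f x / x ^+ 2)) |
  <= a * b * (b - a) / (4 * (p + 1) `^ p^-1)
     * (((1 - q) * (1 - 2 * q) * (b - a) ^+ 2) `^ q^-1)^-1
     * ( (C5 q a b * `|derive_within I f a| `^ q
          + C6 q a b * `|derive_within I f b| `^ q) `^ q^-1
       + (C6 q b a * `|derive_within I f a| `^ q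
          + C5 q b a * `|derive_within I f b| `^ q) `^ q^-1 ).
Proof.
have a0 : 0 < a by have := hIpos _ ha; rewrite /= in_itv/= andbT.
have q0 : 0 < q by lra.
have q2 : 1 < 2 * q by lra.
have p0 : 0 < p.
  rewrite -invr_gt0; have -> : p^-1 = 1 - q^-1 by rewrite -hpq addrK.
  by rewrite subr_gt0 invf_lt1.
have abI : `[a, b] `<=` I by move=> x; rewrite /= in_itv/=; exact: hI.
have intI (x : R) : x \in `]a, b[ -> (I°)%classic x.
  move=> xab; apply: (filterS abI).
  by rewrite -[nbhs x _]/((`[a, b]°)%classic x) interior_itv.
set df := derive_within I f in hconv *.
have Df (x : R) : x \in `]a, b[ -> is_derive x 1 f (df x).
  by move=> /intI xI; apply: derive_within_interior => //; exact: hf.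
have cf : {within `[a, b], continuous f}.
  apply/subspace_continuousP => x xab.
  have := derivable_within_cvg _ _ _ _ (hfab x xab).
  by apply: cvg_trans; apply: cvg_app; apply: within_subset.
have [] := harmonic_primitive _ _ _ _ _ a0 hab cf Df.
set F := (fun x : R => _) => cF DF.
have b0 : 0 < b := lt_trans a0 hab.
have ba0 : 0 < b - a by rewrite subr_gt0.
set D := (1 - q) * (1 - 2 * q) * (b - a) ^+ 2.
have D0 : 0 < D by rewrite mulr_gt0 ?exprn_gt0// nmulr_rgt0 ?subr_lt0.
pose bound (B : R) := a * b * (b - a) ^+ 2 / 2
  * ((2 * (p + 1))^-1 `^ p^-1 * (B / (2 * D)) `^ q^-1).
pose m := a * b / ((a + b) / 2).
(* Abstracting the two sums as [B1] and [B2] leaves an argument in which [C5] and [C6] no longer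
   occur. *)
suff key (B1 B2 : R) : 0 <= B1 / (2 * D) -> 0 <= B2 / (2 * D) ->
    `|F m - F (a * b / a)| <= bound B1 :> R ->
    `|F m - F (a * b / b)| <= bound B2 :> R ->
    `|(f a + f b) / 2 - a * b / (b - a)
       * (\int[@lebesgue_measure R]_(x in `[a, b]) (f x / x ^+ 2))|
    <= a * b * (b - a) / (4 * (p + 1) `^ p^-1) * (D `^ q^-1)^-1
       * (B1 `^ q^-1 + B2 `^ q^-1) :> R.
  have [Y1 F1] := harmonic_half_bound _ p q a b a b _ _ _ a0 hab
    (or_introl (conj erefl erefl)) p0 hq hpq cF DF hconv erefl.
  have [Y2 F2] := harmonic_half_bound _ p q a b b a _ _ _ a0 hab
    (or_intror (conj erefl erefl)) p0 hq hpq cF DF hconv (addrC _ _).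
  exact: (key _ _ Y1 Y2 F1 F2).
(* Here [a b / a] becomes [b] and [a b / b] becomes [a]: the instance [u = a] controls the side next
   to [b], and conversely. *)
move=> Y1 Y2; rewrite mulrAC divff ?gt_eqF// mul1r mulfK ?gt_eqF// => F1 F2.
set S := \int[_]_(x in _) _.
have FbE : F b = - ((b - a) / 2) * f b + a * b * S.
  by rewrite /F -/S; congr (_ * _ + _); field; exact: lt0r_neq0.
have FaE : F a = (b - a) / 2 * f a.
  rewrite /F set_itv1 Rintegral_set1 mulr0 addr0; congr (_ * _).
  by field; exact: lt0r_neq0.
have -> : (f a + f b) / 2 - a * b / (b - a) * S
          = ((F m - F b) - (F m - F a)) / (b - a).
  by rewrite FbE FaE; field; exact: lt0r_neq0.
rewrite normrM [X in _ * X]gtr0_norm ?invr_gt0// ler_pdivrMr//.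
apply: (le_trans (ler_normB _ _)); apply: (le_trans (lerD F1 F2)).
(* What remains is an equality of constants: the 4 is the 2 in [bound] times the 2 from
   [hoelder_constants], and one factor [b - a] comes from clearing the denominator. *)
rewrite le_eqVlt; apply/predU1P; left.
rewrite /bound -mulrDr hoelder_constants//.
by field; rewrite !gt_eqF// powR_gt0// addr_gt0.
Qed.
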